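(* Fix a sub-slot index $l\in\{2,\dots,L\}$. Consider the problem of minimizing, over vectors $\boldsymbol{\gamma}_l=(\gamma_{1,l},\dots,\gamma_{2^J,l})^T$ with entries in $\mathbb{R}_+$, the objective $$\xi(\boldsymbol{\gamma}_l)=f(\boldsymbol{\gamma}_l)+\alpha g(\boldsymbol{\gamma}_l)+\beta\phi(\boldsymbol{\gamma}_l),\qquad \alpha>0,\ \beta>0,$$ where $$f(\boldsymbol{\gamma}_l)=\ln|\boldsymbol{\Psi}_l|+\mathrm{tr}(\boldsymbol{\Psi}_l^{-1}\hat{\boldsymbol{\Psi}}_l^Y),\quad g(\boldsymbol{\gamma}_l)=\|\boldsymbol{\gamma}_l\|_1,\quad \phi(\boldsymbol{\gamma}_l)=\sum_{j\in\mathcal{L}_l}\min_{1\le\hat k\le\hat K_a}\|\mathrm{Log}(\mathbf{G}_{\hat k}^{l-1})-\mathrm{Log}(\gamma_{j,l}\mathbf{I})\|_F^2$$ (maximum-likelihood cost, sparsity-promoting term and stitching-promoting term; all symbols are defined in the context). Let $(\boldsymbol{\gamma}_l^t)_{t\ge0}$ be the iterates of the integrated decoding algorithm described in the context, with step sizes $\eta_l^t$ and initial value $\boldsymbol{\gamma}_l^0$. If the following assumptions hold: (1) $f$ is convex and its gradient is Lipschitz-continuous with constant $C_f$, i.e. $\|\nabla f(\bm{x})-\nabla f(\bm{y})\|\le C_f\|\bm{x}-\bm{y}\|$ for all $\bm{x},\bm{y}$ (in particular for consecutive iterates $\boldsymbol{\gamma}_l^{t+1},\boldsymbol{\gamma}_l^t$);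 (2) $g$ and $\phi$ are convex and their proximal operators $\mathrm{prox}_g,\mathrm{prox}_\phi$ exist; (3) $\xi$ has a minimum value, which is taken at the fixed point $\boldsymbol{\gamma}_l^*$, i.e. the minimum value equals $\xi(\boldsymbol{\gamma}_l^* )$; and the step size satisfies $\eta_l^t=\eta_l\in(0,1/C_f]$ for all $t$, then $$\xi(\boldsymbol{\gamma}_l^t)-\xi(\boldsymbol{\gamma}_l^* )\le\frac{1}{2t\eta_l}\|\boldsymbol{\gamma}_l^0-\boldsymbol{\gamma}_l^*\|^2.$$ That is, when the step size $\eta_l$ satisfies this interval condition determined by the Lipschitz constant $C_f$, the objective function of the algorithm converges to $\xi(\boldsymbol{\gamma}_l^* )$ at the rate $\mathcal{O}(1/t)$, and the step size affects the convergence rate.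
   Context: Setting: a base station with $M$ antennas receives, in each of $L$ sub-slots, a signal $\mathbf{Y}_l\in\mathbb{C}^{n_0\times M}$ formed from codewords of a common codebook $\mathbf{C}=[\bm{c}_1,\dots,\bm{c}_{2^J}]\in\mathbb{C}^{n_0\times 2^J}$ plus white Gaussian noise of variance $\sigma^2$. The vector $\boldsymbol{\gamma}_l$ is the codeword activity vector of sub-slot $l$, $\boldsymbol{\Gamma}_l=\mathrm{diag}(\boldsymbol{\gamma}_l)$, $\boldsymbol{\Psi}_l=\mathbf{C}\boldsymbol{\Gamma}_l\mathbf{C}^H+\sigma^2\mathbf{I}$ and $\hat{\boldsymbol{\Psi}}_l^Y=\frac1M\mathbf{Y}_l\mathbf{Y}_l^H$. $|\cdot|$ of a matrix is its determinant, $\|\cdot\|$ is the Euclidean norm, $\|\cdot\|_F$ the Frobenius norm, and $\mathrm{Log}$ and $\exp$ are the matrix logarithm and exponential. $\mathcal{L}_l\subseteq\{1,\dots,2^J\}$ is the list of active codewords in sub-slot $l$ (in running the algorithm it is replaced by its current estimate). $\hat K_a$ is the number of active users estimated in the first sub-slot, equal to the number of classes $\mathcal{C}_1,\dots,\mathcal{C}_{\hat K_a}$ into which detected codewords are grouped. $\mathbf{G}_{\hat k}^{l-1}=\exp\left[\frac{1}{l-1}\sum_{i=1}^{l-1}\mathrm{Log}(\hat\gamma_{j_i,i}\mathbf{I})\right]$ is the geometric center of class $\hat k$, where $j_i$ is the codeword index detected in sub-slot $i$ and assigned to class $\mathcal{C}_{\hat k}$, and $\hat\gamma_{j_i,i}$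 is its estimated activity value. Here $\mathbf{I}$ is the $M\times M$ identity, and $\gamma_{j,l}\mathbf{I}$ ($j\in\mathcal{L}_l$) is a Hermitian positive definite codeword covariance matrix. The centers are fixed when sub-slot $l$ is processed. Proximal operator: $\mathrm{prox}_{\eta h}(\bm{v})=\arg\min_{\bm{x}}\, h(\bm{x})+\frac{1}{2\eta}\|\bm{x}-\bm{v}\|_2^2$. Algorithm: the iterates are given by the proximal gradient iteration $$\boldsymbol{\gamma}_l^{t+1}=\mathrm{prox}_{\eta_l^t(\alpha g+\beta\phi)}\left(\boldsymbol{\gamma}_l^t-\eta_l^t\nabla f(\boldsymbol{\gamma}_l^t)\right),$$ that is, $\boldsymbol{\gamma}_l^{t+1}=\boldsymbol{\gamma}_l^t-\eta_l^t\nabla f(\boldsymbol{\gamma}_l^t)-\alpha\eta_l^t\partial g(\boldsymbol{\gamma}_l^{t+1})-\beta\eta_l^t\partial\phi(\boldsymbol{\gamma}_l^{t+1})$ with $\partial$ denoting subgradients. The algorithm carries it out in the following Douglas–Rachford split form, which the source takes to be equivalent: $$\bm{z}^t=\mathrm{prox}_{\eta_l^t(\alpha g)}\left(\boldsymbol{\gamma}_l^t-\eta_l^t\nabla f(\boldsymbol{\gamma}_l^t)-\eta_l^t\beta\bm{u}^t\right),\quad \boldsymbol{\gamma}_l^{t+1}=\mathrm{prox}_{\eta_l^t(\beta\phi)}\left(\bm{z}^t+\eta_l^t\beta\bm{u}^t\right),\quad \bm{u}^{t+1}=\bm{u}^t+\frac{1}{\eta_l^t\beta}(\bm{z}^t-\boldsymbol{\gamma}_l^{t+1}),$$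 with auxiliary variable $\bm{z}^t$ and error signal $\bm{u}^t$ initialised at $\bm{0}$. ''Fixed point'' refers to a fixed point of this iteration. *)

(* Defs.v *)
(* MathComp / MathComp-Analysis; complex numbers are R[i] over R : realType. *)
From HB Require Import structures.
From mathcomp Require Export all_boot all_order all_algebra.
From mathcomp Require Export all_classical all_reals all_analysis.
From mathcomp Require Export complex.

Set Implicit Arguments.
Unset Strict Implicit.
Unset Printing Implicit Defensive.

Export Order.TTheory GRing.Theory Num.Theory.
Export numFieldNormedType.Exports.

Local Open Scope classical_set_scope.
Local Open Scope ring_scope.
Local Open Scope complex_scope.
Local Open Scope sesquilinear_scope.

(* The library norm on 'cV[R]_n is the sup norm, hence this definition. *)
Definition enorm (R : realType) (n : nat) (x : 'cV[R]_n) : R :=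
  Num.sqrt (\sum_(i < n) x i 0 ^+ 2).

Definition grad (R : realType) (n : nat) (f : 'cV[R]_n -> R)
    (x : 'cV[R]_n) : 'cV[R]_n :=
  \col_i 'D_(delta_mx i 0) (f : 'cV[R]_n -> R^o) x.

Definition frob_norm (R : realType) (m n : nat) (A : 'M[R[i]]_(m, n)) : R :=
  Num.sqrt (\sum_(i < m) \sum_(j < n)
    (complex.Re (A i j) ^+ 2 + complex.Im (A i j) ^+ 2)).

Definition expmx_psum (R : realType) (m : nat) (A : 'M[R[i]]_m) (N : nat) :
    'M[R[i]]_m :=
  \sum_(k < N) (k`!%:R)^-1 *: A ^+ k.

(* sum of the exponential series; the limit is taken separately in the real
   and imaginary parts of each entry *)
Definition expmx (R : realType) (m : nat) (A : 'M[R[i]]_m) : 'M[R[i]]_m :=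
  \matrix_(i, j)
    (limn (fun N => complex.Re (expmx_psum A N i j) : R^o) +i*
     limn (fun N => complex.Im (expmx_psum A N i j) : R^o)).

(* principal logarithm of a Hermitian positive definite matrix: its unique
   Hermitian logarithm; a junk value (0) on matrices that have none *)
Definition logmx (R : realType) (m : nat) (A : 'M[R[i]]_m) : 'M[R[i]]_m :=
  xget 0 [set X | X \is hermsymmx /\ expmx X = A].

Definition argmin_on (T : Type) (R : realType) (A : set T) (F : T -> R)
    (x : T) : Prop :=
  A x /\ forall y, A y -> F x <= F y.

(* x = prox_{eta h}(v), where A is the domain of h (h is +oo outside A) *)
Definition is_prox (R : realType) (n : nat) (A : set 'cV[R]_n) (eta : R)
    (h : 'cV[R]_n -> R) (v x : 'cV[R]_n) : Prop :=
  argmin_on A (fun y => h y + (2 * eta)^-1 * enorm (y - v) ^+ 2) x.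

Definition nonneg_orthant (R : realType) (n : nat) : set 'cV[R]_n :=
  [set x | forall j, 0 <= x j 0].

(* the elements of the nonnegative orthant at which Log (x_j I) makes sense
   for all j in Lset *)
Definition feasible (R : realType) (n : nat) (Lset : {set 'I_n}) :
    set 'cV[R]_n :=
  [set x | nonneg_orthant x /\ forall j, j \in Lset -> 0 < x j 0].

Definition cov (R : realType) (n0 n : nat) (C : 'M[R[i]]_(n0, n)) (sigma : R)
    (x : 'cV[R]_n) : 'M[R[i]]_n0 :=
  C *m diag_mx (map_mx (real_complex R) x)^T *m C ^t* +
  ((sigma ^+ 2)%:C)%:M.

Definition sample_cov (R : realType) (n0 M : nat) (Y : 'M[R[i]]_(n0, M)) :
    'M[R[i]]_n0 :=
  M%:R^-1 *: (Y *m Y ^t*).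

(* On the nonnegative orthant the determinant and the trace are real; Re only
   maps them back to R. *)
Definition ml_cost (R : realType) (n0 n M : nat) (C : 'M[R[i]]_(n0, n))
    (sigma : R) (Y : 'M[R[i]]_(n0, M)) (x : 'cV[R]_n) : R :=
  ln (complex.Re (\det (cov C sigma x))) +
  complex.Re (\tr (invmx (cov C sigma x) *m sample_cov Y)).

Definition l1_norm (R : realType) (n : nat) (x : 'cV[R]_n) : R :=
  \sum_(j < n) `|x j 0|.

(* idx i is the codeword detected in sub-slot i and assigned to the class,
   act i the activity vector estimated in sub-slot i; sub-slots are numbered
   from 1. *)
Definition center (R : realType) (n M l : nat) (act : nat -> 'cV[R]_n)
    (idx : nat -> 'I_n) : 'M[R[i]]_M :=
  expmx ((l.-1)%:R^-1 *:
    \sum_(1 <= i < l) logmx ((act i (idx i) 0)%:C)%:M).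

Definition stitch_cost (R : realType) (n M K : nat) (Lset : {set 'I_n})
    (G : 'I_K -> 'M[R[i]]_M) (x : 'cV[R]_n) : R :=
  \sum_(j in Lset)
    fine (\big[Order.min/+oo%E]_(k < K)
      (frob_norm (logmx (G k) - logmx ((x j 0)%:C)%:M) ^+ 2)%:E).

(* Main.v *)
(* The cost [f] is smooth near the nonnegative orthant, where the covariance is
   positive definite; so on [D] the descent lemma and the first-order
   convexity inequality hold.  Adding the optimality inequality of the proximal
   step gives, for every [z] in [D] and in the domain of [phi],
     xi(x') <= xi(z) + (|x - z|^2 - |x' - z|^2) / (2 eta),
   where [x'] is the iterate following [x].  With [z = x] this shows that [xi]
   decreases, with [z = gams] it telescopes. *)
Require Import Defs.
From mathcomp Require Import ring lra.

Set Implicit Arguments.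
Unset Strict Implicit.
Unset Printing Implicit Defensive.

Local Open Scope classical_set_scope.
Local Open Scope ring_scope.

(** * Euclidean inner product and norm *)

Definition dotv (R : realType) (n : nat) (x y : 'cV[R]_n) : R :=
  \sum_i x i 0 * y i 0.

Section EuclideanSpace.
Context {R : realType} {n : nat}.
Implicit Types (x y z : 'cV[R]_n) (a : R).

Lemma dotvC x y : dotv x y = dotv y x.
Proof. by apply: eq_bigr => i _; rewrite mulrC. Qed.

Lemma dotvDl x y z : dotv (x + y) z = dotv x z + dotv y z.
Proof. by rewrite -big_split; apply: eq_bigr => i _; rewrite mxE mulrDl. Qed.

Lemma dotvDr x y z : dotv x (y + z) = dotv x y + dotv x z.
Proof. by rewrite dotvC dotvDl !(dotvC x). Qed.

Lemma dotvZl a x y : dotv (a *: x) y = a * dotv x y.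
Proof. by rewrite mulr_sumr; apply: eq_bigr => i _; rewrite mxE mulrA. Qed.

Lemma dotvZr a x y : dotv x (a *: y) = a * dotv x y.
Proof. by rewrite dotvC dotvZl dotvC. Qed.

Lemma dotvNl x y : dotv (- x) y = - dotv x y.
Proof. by rewrite -scaleN1r dotvZl mulN1r. Qed.

Lemma dotvNr x y : dotv x (- y) = - dotv x y.
Proof. by rewrite dotvC dotvNl dotvC. Qed.

Lemma enorm_ge0 x : 0 <= enorm x.
Proof. exact: sqrtr_ge0. Qed.

Lemma sqr_enorm x : enorm x ^+ 2 = dotv x x.
Proof.
rewrite sqr_sqrtr; last by apply: sumr_ge0 => i _; exact: sqr_ge0.
by apply: eq_bigr => i _; rewrite expr2.
Qed.

Lemma enormZ a x : 0 <= a -> enorm (a *: x) = a * enorm x.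
Proof.
move=> a0; apply/eqP; rewrite -(@eqrXn2 _ 2%N) ?mulr_ge0 ?enorm_ge0//.
by rewrite exprMn !sqr_enorm dotvZl dotvZr mulrA expr2.
Qed.

(** Cauchy-Schwarz in the form used for the descent lemma. Expanding [0 <= |x - k y|^2] gives [2 k
    <x, y> <= |x|^2 + k^2 |y|^2 <= 2 k^2 |y|^2], and [2 k] cancels. *)
Lemma dotv_le_enorm k x y : 0 < k -> enorm x <= k * enorm y ->
  dotv x y <= k * enorm y ^+ 2.
Proof.
move=> k0 xy; have k0' := ltW k0.
have : enorm x ^+ 2 <= (k * enorm y) ^+ 2.
  by rewrite lerXn2r ?nnegrE ?mulr_ge0 ?enorm_ge0.
have : 0 <= enorm (x - k *: y) ^+ 2 by exact: sqr_ge0.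
rewrite exprMn !sqr_enorm.
rewrite !(dotvDl, dotvDr, dotvNl, dotvNr, dotvZl, dotvZr) (dotvC y x).
move=> h1 h2; rewrite -(ler_pM2l k0); nra.
Qed.

End EuclideanSpace.

(** Replaces letting [s] tend to 0. If [a > 0], the choice [s = 1/2] forces [b > 0], and then
    [s = a / (2 b)] gives [a <= a / 2]. *)
Lemma le0_of_le_small_mul (R : realType) (a b : R) :
  (forall s, 0 < s < 1 -> a <= s * b) -> a <= 0.
Proof.
move=> h; rewrite leNgt; apply/negP => a0.
have h2 : a <= 2^-1 * b by apply: h; lra.
have b0 : 0 < b by lra.
have ab : a / (2 * b) <= 2^-1 by rewrite ler_pdivrMr; lra.
have : a <= a / (2 * b) * b.
  by apply: h; rewrite divr_gt0 ?mulr_gt0//=; lra.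
suff -> : a / (2 * b) * b = a / 2 by lra.
by field; rewrite gt_eqF.
Qed.

(** * First-order inequalities for convex functions, smooth functions and proximal points *)

Section ConvexGradient.
Context {R : realType} {n : nat}.
Implicit Types (x y z v : 'cV[R]_n) (D A : set 'cV[R]_n)
  (f h : 'cV[R]_n -> R).

(** Gateaux differentiability with gradient [grad f x]. Since [grad] only collects partial
    derivatives, linearity in the direction [v] has to be stated separately. *)
Definition grad_diff f x :=
  forall v, is_derive x v (f : 'cV[R]_n -> R^o) (dotv (grad f x) v).

(** [conv] puts the weight [s] on its first argument, so the end point [y] comes first. *)
Lemma conv_segment x y s (s0 : 0 <= s) (s1 : s <= 1) :
  conv (Itv01 s0 s1) (y : convex_lmodType 'cV[R]_n)
    (x : convex_lmodType 'cV[R]_n) = x + s *: (y - x).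
Proof.
rewrite /conv/= /unstable.onem scalerBl scale1r scalerBr addrA.
by rewrite [s *: y + x]addrC addrA.
Qed.

Lemma convex_setP D : convex_set (M := 'cV[R]_n) D ->
  forall x y s, D x -> D y -> 0 <= s <= 1 -> D (x + s *: (y - x)).
Proof.
move=> cD x y s Dx Dy /andP[s0 s1].
have := cD y x (Itv01 s0 s1) (mem_set Dy) (mem_set Dx).
by rewrite conv_segment inE.
Qed.

Lemma convex_functionP D f : convex_function (E := 'cV[R]_n) D f ->
  forall x y s, D x -> D y -> 0 <= s <= 1 ->
  f (x + s *: (y - x)) <= f x + s * (f y - f x).
Proof.
move=> cf x y s Dx Dy /andP[s0 s1].
have := cf (Itv01 s0 s1) y x (mem_set Dy) (mem_set Dx).
rewrite conv_segment => /le_trans; apply.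
rewrite /conv/= /unstable.onem /conv/= /unstable.onem /GRing.scale/=; lra.
Qed.

(** No chain rule is involved: the difference quotient at [s] of the restriction to the line is the
    directional difference quotient at [x + s *: v]. *)
Lemma is_derive_along_line f x v (s : R) : grad_diff f (x + s *: v) ->
  is_derive s 1 (fun r : R => f (x + r *: v) : R^o)
    (dotv (grad f (x + s *: v)) v).
Proof.
move=> /(_ v)[dv eqv].
have E : (fun h : R => h^-1 *: ((f (x + (h *: (1 : R^o) + s) *: v) : R^o)
            - f (x + s *: v))) =
    (fun h : R => h^-1 *: ((f (h *: v + (x + s *: v)) : R^o) - f (x + s *: v))).
  apply/funext => h; congr (_ *: (f _ - _)).
  have -> : h *: (1 : R^o) = h by rewrite /GRing.scale/= mulr1.
  by rewrite scalerDl addrCA.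
split; first by rewrite /derivable/= E.
by rewrite -eqv /derive/= E.
Qed.

Lemma convex_grad_le D f x y : convex_set (M := 'cV[R]_n) D ->
  convex_function (E := 'cV[R]_n) D f -> D x -> D y -> grad_diff f x ->
  f x + dotv (grad f x) (y - x) <= f y.
Proof.
move=> cD cf Dx Dy /(_ (y - x))[dv eqv].
rewrite -lerBrDl -eqv /derive.
(* Convexity bounds the difference quotient by [f y - f x] only for steps in []0, 1]], hence the
   passage to the right limit. *)
have /cvg_at_rightE-> := dv.
apply: limr_le.
  by move/cvg_ex: dv => [l /cvg_dnbhs_at_right dl]; apply/cvg_ex; exists l.
near=> s.
have s0 : 0 < s by [].
have s1 : s <= 1 by near: s; apply: nbhs_right_le.
rewrite /GRing.scale/= ler_pdivrMl// lerBlDl.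
by rewrite [_ + x]addrC (convex_functionP cf) // (ltW s0).
Unshelve. all: by end_near. Qed.

(** The mean value theorem takes the place of integrating the gradient. Let [p] be the restriction
    of [f] to the segment minus the claimed quadratic bound without its constant term. Then
    [p 1 - p 0 = dp c], and [dp c <= 0] because the Lipschitz bound gives [<grad f (x + c v) - grad
    f x, v> <= L c |v|^2]. *)
Lemma descent_lemma D f L x y : convex_set (M := 'cV[R]_n) D -> 0 < L ->
  (forall z, D z -> grad_diff f z) ->
  (forall z w, D z -> D w ->
     enorm (grad f z - grad f w) <= L * enorm (z - w)) ->
  D x -> D y ->
  f y <= f x + dotv (grad f x) (y - x) + L / 2 * enorm (y - x) ^+ 2.
Proof.
move=> cD L0 df lip Dx Dy.
set v := y - x.
have Ds (s : R) : 0 <= s <= 1 -> D (x + s *: v) by exact: convex_setP.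
pose p (s : R) : R := f (x + s *: v) - s * dotv (grad f x) v
  - s ^+ 2 * (L / 2 * enorm v ^+ 2).
pose dp (s : R) : R := dotv (grad f (x + s *: v)) v - dotv (grad f x) v
  - 2 * s * (L / 2 * enorm v ^+ 2).
have dpP (s : R) : 0 <= s <= 1 -> is_derive s 1 (p : R -> R^o) (dp s).
  move=> s01; have ds := is_derive_along_line (df _ (Ds s s01)).
  have dl (c : R) : is_derive s 1 (fun r : R => r * c : R^o) c.
    have := is_deriveM (is_derive_id s (1 : R^o)) (is_derive_cst (c : R^o) s 1).
    by move=> /is_derive_eq; apply; rewrite scaler0 add0r /GRing.scale/= mulr1.
  have dq (c : R) : is_derive s 1 (fun r : R => r ^+ 2 * c : R^o) (2 * s * c).
    have := is_deriveM (is_derive_id s (1 : R^o)) (dl c).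
    have -> : (fun r : R => r ^+ 2 * c : R^o) =
        (@id R^o * (fun r : R => r * c : R^o)).
      by apply/funext => r; rewrite expr2 -mulrA.
    by move=> /is_derive_eq; apply; rewrite /GRing.scale/=; ring.
  by apply: is_deriveB; exact: is_deriveB.
have [c c01] : exists2 c, c \in `]0, 1[%R & p 1 - p 0 = dp c * (1 - 0).
  apply: MVT => // [s|].
    by rewrite in_itv/= => /andP[? ?]; apply: dpP; rewrite !ltW.
  apply: derivable_within_continuous => s; rewrite in_itv/= => s01.
  by have [] := dpP s s01.
have /andP[c0 c1] : 0 < c < 1 by move: c01; rewrite in_itv.
rewrite subr0 mulr1 /p scale0r scale1r addr0 /dp => pE.
have xy : x + v = y by rewrite /v addrC subrK.
have : dotv (grad f (x + c *: v) - grad f x) v <= L * c * enorm v ^+ 2.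
  apply: dotv_le_enorm; first exact: mulr_gt0.
  rewrite -mulrA -(enormZ _ (ltW c0)).
  have c01' : 0 <= c <= 1 by rewrite !ltW.
  by have := lip _ _ (Ds c c01') Dx; rewrite addrAC subrr add0r.
rewrite dotvDl dotvNl.
move: pE; rewrite xy.
nra.
Qed.

(** States without subgradients that [(v - x) / eta] is a subgradient of [h] at [x]. Minimality is
    tested against [x + s (z - x)], which stays in [A]. After convexity of [h] and division by [s],
    the remainder is [s |z - x|^2 / (2 eta)], which vanishes with [s]. *)
Lemma prox_le D A (eta : R) h v x z :
  convex_set (M := 'cV[R]_n) D -> convex_set (M := 'cV[R]_n) A ->
  convex_function (E := 'cV[R]_n) (D `&` A) h -> 0 < eta ->
  is_prox A eta h v x -> D x -> (D `&` A) z ->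
  h x <= h z + eta^-1 * dotv (x - v) (z - x).
Proof.
move=> cD cA ch eta0 [Ax xmin] Dx [Dz Az].
rewrite -subr_le0.
apply: (@le0_of_le_small_mul _ _ ((2 * eta)^-1 * enorm (z - x) ^+ 2)) => s.
move=> /andP[s0 s1]; have s01 : 0 <= s <= 1 by rewrite !ltW.
have := xmin _ (convex_setP cA Ax Az s01).
have := convex_functionP ch (conj Dx Ax) (conj Dz Az) s01.
have -> : x + s *: (z - x) - v = (x - v) + s *: (z - x) by rewrite addrAC.
set w := z - x; set u := x - v.
rewrite !sqr_enorm !(dotvDl u) !(dotvDr _ u) !(dotvZl, dotvZr) (dotvC w u).
rewrite invfM => h1 h2.
rewrite -(ler_pM2l s0).
move: (dotv u u) (dotv u w) (dotv w w) h1 h2 => uu uw ww.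
move: (eta^-1) => k.
nra.
Qed.

End ConvexGradient.

(** * One proximal gradient step and the rate of the iteration *)

Section ProximalGradient.
Context {R : realType} {n : nat}.
Variables (D A : set 'cV[R]_n) (f h : 'cV[R]_n -> R) (L eta : R).
Hypotheses (cD : convex_set (M := 'cV[R]_n) D)
  (cA : convex_set (M := 'cV[R]_n) A)
  (cf : convex_function (E := 'cV[R]_n) D f)
  (ch : convex_function (E := 'cV[R]_n) (D `&` A) h)
  (df : forall z, D z -> grad_diff f z)
  (lip : forall z w, D z -> D w ->
     enorm (grad f z - grad f w) <= L * enorm (z - w))
  (L0 : 0 < L) (eta0 : 0 < eta) (etaL : eta <= 1 / L).

Lemma prox_grad_step x x' z : D x -> D x' -> (D `&` A) z ->
  is_prox A eta h (x - eta *: grad f x) x' ->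
  f x' + h x' <= f z + h z
    + (2 * eta)^-1 * (enorm (x - z) ^+ 2 - enorm (x' - z) ^+ 2).
Proof.
move=> Dx Dx' DAz px'.
have desc := descent_lemma cD L0 df lip Dx Dx'.
have cvx := convex_grad_le cD cf Dx DAz.1 (df Dx).
have prx := prox_le cD cA ch eta0 px' Dx' DAz.
(* This is where the step size bound enters: the descent error [L/2 |x' - x|^2] is absorbed by
   [|x' - x|^2 / (2 eta)]. *)
have Leta : L <= eta^-1 by rewrite -(invrK L) lef_pV2 ?posrE ?invr_gt0// -div1r.
have -> : x' - z = - (z - x') by rewrite opprB.
have -> : x - z = - (x' - x) - (z - x').
  by apply/matrixP => i j; rewrite !mxE; ring.
move: desc cvx prx.
have -> : z - x = (x' - x) + (z - x').
  by apply/matrixP => i j; rewrite !mxE; ring.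
have -> : x' - (x - eta *: grad f x) = (x' - x) + eta *: grad f x.
  by apply/matrixP => i j; rewrite !mxE; ring.
have : 0 <= enorm (x' - x) ^+ 2 by exact: sqr_ge0.
have : 0 < eta^-1 by rewrite invr_gt0.
have : eta^-1 * eta = 1 by rewrite mulVf// gt_eqF.
(* In these variables the gradient terms [<g, d>] and [<g, e>] cancel in the sum of the three
   inequalities. What remains is [<d, e> / eta + L/2 |d|^2], to be compared with
   [(|d + e|^2 - |e|^2) / (2 eta)]. *)
move: (x' - x) (z - x') (grad f x) => d e g.
rewrite !sqr_enorm !(dotvDl, dotvDr, dotvNl, dotvNr, dotvZl, dotvZr).
rewrite (dotvC e d).
rewrite invfM.
move: (dotv d d) (dotv d e) (dotv e e) (dotv g d) (dotv g e) => dd de ee gd ge.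
move: (eta^-1) Leta => k kL.
move=> ke k0 dd0 h1 h2 h3.
have : k * (eta * ge) = ge by rewrite mulrA ke mul1r.
nra.
Qed.

Variables (gam : nat -> 'cV[R]_n) (gams : 'cV[R]_n).
Hypotheses (Dgam : forall t, D (gam t)) (DAgams : (D `&` A) gams)
  (iter : forall t, is_prox A eta h (gam t - eta *: grad f (gam t)) (gam t.+1)).

Lemma prox_grad_nonincreasing t : f (gam t.+2) + h (gam t.+2)
  <= f (gam t.+1) + h (gam t.+1).
Proof.
(* The comparison point must lie in [A], which holds for [gam t.+1] as the output of a proximal
   step. *)
have DA1 : (D `&` A) (gam t.+1) by split=> //; exact: (iter t).1.
have := prox_grad_step (Dgam t.+1) (Dgam t.+2) DA1 (iter t.+1).
rewrite subrr sqr_enorm.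
have -> : dotv (0 : 'cV[R]_n) 0 = 0 by rewrite -(scale0r 0) dotvZl mul0r.
move=> /le_trans; apply; rewrite sub0r mulrN gerDl oppr_le0.
by rewrite mulr_ge0 ?sqr_ge0// invr_ge0 mulr_ge0// ltW.
Qed.

(* [gam 0] may lie outside [A], where [h] is meaningless, so the values are
   only compared from the first iterate on. *)
Lemma prox_grad_rate t : (0 < t)%N ->
  f (gam t) + h (gam t) - (f gams + h gams)
    <= 1 / (2 * t%:R * eta) * enorm (gam 0%N - gams) ^+ 2.
Proof.
case: t => // t _.
(* The distance to [gams] after the last step is kept in the bound so that it cancels against the
   next step. Monotonicity allows all earlier gaps to be replaced by the newest one, which is why
   the factor is the number of steps. *)
have tel : t.+1%:R * (f (gam t.+1) + h (gam t.+1) - (f gams + h gams))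
    <= (2 * eta)^-1 * (enorm (gam 0%N - gams) ^+ 2
                       - enorm (gam t.+1 - gams) ^+ 2).
  elim: t => [|t IH].
    rewrite mul1r lerBlDl.
    exact: (prox_grad_step (Dgam 0) (Dgam 1) DAgams (iter 0)).
  have := prox_grad_step (Dgam t.+1) (Dgam t.+2) DAgams (iter t.+1).
  have mono := prox_grad_nonincreasing t.
  have : t.+1%:R * (f (gam t.+2) + h (gam t.+2))
      <= t.+1%:R * (f (gam t.+1) + h (gam t.+1)) by rewrite ler_wpM2l.
  move: IH; rewrite -[t.+2]addn1 natrD; move: (t.+1%:R : R) => T; nra.
have t0 : 0 < t.+1%:R :> R by rewrite ltr0n.
rewrite -(ler_pM2l t0); apply: (le_trans tel).
have -> : t.+1%:R * (1 / (2 * t.+1%:R * eta) * enorm (gam 0%N - gams) ^+ 2) =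
  (2 * eta)^-1 * enorm (gam 0%N - gams) ^+ 2.
  by field; rewrite !gt_eqF.
by rewrite ler_wpM2l ?gerBl ?sqr_ge0// invr_ge0 mulr_ge0// ltW.
Qed.

End ProximalGradient.

(** The lower bound [c] makes the one-sided rate two-sided: it gives a squeeze for the limit and
    removes the absolute value for the order. *)
Lemma cvg_bigO_of_le_inv (R : realType) (u : nat -> R) (c k : R) :
  (forall t, (0 < t)%N -> c <= u t) ->
  (forall t, (0 < t)%N -> u t - c <= k * t%:R^-1) ->
  ((u t : R^o) @[t --> \oo] --> (c : R^o)) /\
  ((fun t => u t - c : R^o) =O_\oo (fun t => t%:R^-1 : R^o)).
Proof.
move=> cu uk; split.
  have lim0 : (fun t => c + k * t%:R^-1 : R) @ \oo --> c.
    rewrite -[X in _ --> X]addr0 -(mulr0 k).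
    apply: cvgD; first exact: cvg_cst.
    apply: cvgM; first exact: cvg_cst.
    apply: (@gtr0_cvgV0 _ _ \oo _ (fun t => t%:R : R) _).2.
      by near=> t; rewrite ltr0n; near: t; exists 1%N.
    exact: cvgr_idn.
  apply: (squeeze_cvgr _ (cvg_cst c) lim0).
  near=> t; have t0 : (0 < t)%N by near: t; exists 1%N.
  by rewrite cu// -lerBlDl uk.
(* The constant must be positive, while [k] has arbitrary sign. *)
apply/eqO_exP; exists (`|k| + 1); first by rewrite ltr_wpDl.
near=> t; have t0 : (0 < t)%N by near: t; exists 1%N.
rewrite /= ger0_norm ?subr_ge0 ?cu// [X in _ <= _ * X]ger0_norm ?invr_ge0//.
apply: (le_trans (uk _ t0)); rewrite ler_wpM2r ?invr_ge0//.
by apply: (le_trans (ler_norm _)); rewrite lerDl.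
Unshelve. all: by end_near. Qed.

(** * Convexity of restrictions, of weighted sums and of the feasible set *)

Lemma sub_convex_function (R : realType) n (D D' : set 'cV[R]_n)
    (f : 'cV[R]_n -> R) : D' `<=` D ->
  convex_function (E := 'cV[R]_n) D f -> convex_function (E := 'cV[R]_n) D' f.
Proof.
move=> D'D cf s x y; rewrite !inE => /D'D xD /D'D yD.
by apply: cf; rewrite inE.
Qed.

Lemma convex_functionD (R : realType) n (D : set 'cV[R]_n)
    (f g : 'cV[R]_n -> R) (a b : R) : 0 <= a -> 0 <= b ->
  convex_function (E := 'cV[R]_n) D f -> convex_function (E := 'cV[R]_n) D g ->
  convex_function (E := 'cV[R]_n) D (fun x => a * f x + b * g x).
Proof.
move=> a0 b0 cf cg s x y xD yD.
have := cf s x y xD yD; have := cg s x y xD yD.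
rewrite !convRE => hg hf.
apply: (le_trans (lerD (ler_wpM2l a0 hf) (ler_wpM2l b0 hg))).
by rewrite le_eqVlt; apply/orP; left; apply/eqP; ring.
Qed.

Lemma feasible_convex (R : realType) n (S : {set 'I_n}) :
  convex_set (M := 'cV[R]_n) (feasible (R := R) S).
Proof.
move=> x y s; rewrite !inE => -[x0 xS] [y0 yS].
have s0 : 0 <= s%:num by [].
have s1 : 0 <= 1 - s%:num by rewrite subr_ge0.
have convE j : (conv s x y : 'cV[R]_n) j 0 =
    s%:num * (x : 'cV[R]_n) j 0 + (1 - s%:num) * (y : 'cV[R]_n) j 0.
  by rewrite /conv/= /unstable.onem !mxE.
split=> j; first by rewrite convE addr_ge0 ?mulr_ge0 ?x0 ?y0.
by move=> jS; have := convR_gt0 s (xS j jS) (yS j jS); rewrite convRE convE.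
Qed.

Local Open Scope complex_scope.
Local Open Scope sesquilinear_scope.

(** * Differentiability of complex-valued functions on a real space *)

Section ReImArithmetic.
Context {R : realType}.
Implicit Types z w : R[i].
Local Notation Re := complex.Re.
Local Notation Im := complex.Im.

Lemma ReD z w : Re (z + w) = Re z + Re w.
Proof. by case: z w => a b []. Qed.

Lemma ImD z w : Im (z + w) = Im z + Im w.
Proof. by case: z w => a b []. Qed.

Lemma ReM z w : Re (z * w) = Re z * Re w - Im z * Im w.
Proof. by case: z w => a b []. Qed.

Lemma ImM z w : Im (z * w) = Re z * Im w + Im z * Re w.
Proof. by case: z w => a b []. Qed.

Lemma ReV z : Re z^-1 = Re z * (Re z * Re z + Im z * Im z)^-1.
Proof. by case: z. Qed.

Lemma ImV z : Im z^-1 = - (Im z * (Re z * Re z + Im z * Im z)^-1).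
Proof. by case: z. Qed.

End ReImArithmetic.

Section ComplexDifferentiable.
Context {R : realType} {V : normedModType R}.
Implicit Types (F G : V -> R[i]) (x : V).

(** Real differentiability, not holomorphy: the variable ranges over a real normed space, so the two
    parts are treated as real functions. *)
Definition cdifferentiable F x :=
  differentiable (fun y => complex.Re (F y) : R^o) x /\
  differentiable (fun y => complex.Im (F y) : R^o) x.

Lemma cdifferentiable_cst (c : R[i]) x : cdifferentiable (fun=> c) x.
Proof. by split; exact: differentiable_cst. Qed.

Lemma cdifferentiable_real (u : V -> R) x : differentiable (u : V -> R^o) x ->
  cdifferentiable (fun y => (u y)%:C) x.
Proof. by move=> du; split=> //; exact: differentiable_cst. Qed.

Lemma cdifferentiableD F G x : cdifferentiable F x -> cdifferentiable G x ->
  cdifferentiable (fun y => F y + G y) x.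
Proof.
move=> [rF iF] [rG iG]; split.
  have -> : (fun y => complex.Re (F y + G y) : R^o) =
     (fun y => complex.Re (F y) : R^o) + (fun y => complex.Re (G y) : R^o).
    by apply/funext => y; exact: ReD.
  exact: differentiableD.
have -> : (fun y => complex.Im (F y + G y) : R^o) =
   (fun y => complex.Im (F y) : R^o) + (fun y => complex.Im (G y) : R^o).
  by apply/funext => y; exact: ImD.
exact: differentiableD.
Qed.

Lemma cdifferentiableM F G x : cdifferentiable F x -> cdifferentiable G x ->
  cdifferentiable (fun y => F y * G y) x.
Proof.
move=> [rF iF] [rG iG]; split.
  have -> : (fun y => complex.Re (F y * G y) : R^o) =
     (fun y => complex.Re (F y) : R) * (fun y => complex.Re (G y) : R) \-
     (fun y => complex.Im (F y) : R) * (fun y => complex.Im (G y) : R).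
    by apply/funext => y; exact: ReM.
  by apply: differentiableB; exact: differentiableM.
have -> : (fun y => complex.Im (F y * G y) : R^o) =
   (fun y => complex.Re (F y) : R) * (fun y => complex.Im (G y) : R) +
   (fun y => complex.Im (F y) : R) * (fun y => complex.Re (G y) : R).
  by apply/funext => y; exact: ImM.
by apply: differentiableD; exact: differentiableM.
Qed.

Lemma cdifferentiable_sum (I : Type) (r : seq I) (P : pred I)
    (F : I -> V -> R[i]) x : (forall i, cdifferentiable (F i) x) ->
  cdifferentiable (fun y => \sum_(i <- r | P i) F i y) x.
Proof.
move=> dF; elim: r => [|i r IH].
  under eq_fun do rewrite big_nil; exact: cdifferentiable_cst.
under eq_fun do rewrite big_cons.
by case: (P i) => //; exact: cdifferentiableD.
Qed.

Lemma cdifferentiable_prod (I : Type) (r : seq I) (P : pred I)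
    (F : I -> V -> R[i]) x : (forall i, cdifferentiable (F i) x) ->
  cdifferentiable (fun y => \prod_(i <- r | P i) F i y) x.
Proof.
move=> dF; elim: r => [|i r IH].
  under eq_fun do rewrite big_nil; exact: cdifferentiable_cst.
under eq_fun do rewrite big_cons.
by case: (P i) => //; exact: cdifferentiableM.
Qed.

Lemma cdifferentiableV F x : cdifferentiable F x -> F x != 0 ->
  cdifferentiable (fun y => (F y)^-1) x.
Proof.
move=> [rF iF] F0.
(* [N] is the squared modulus of [F], the real denominator of the inverse. *)
pose N := (fun y => complex.Re (F y) : R) * (fun y => complex.Re (F y) : R) +
          (fun y => complex.Im (F y) : R) * (fun y => complex.Im (F y) : R).
have dN : differentiable N x by apply: differentiableD; exact: differentiableM.
have N0 : N x != 0.
  apply: contra F0; rewrite /N /= paddr_eq0 -?expr2 ?sqr_ge0// !sqrf_eq0.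
  by rewrite eq_complex.
have dV : differentiable (fun y => (N y)^-1) x by exact: differentiableV.
split.
  have -> : (fun y => complex.Re (F y)^-1 : R^o) =
      (fun y => complex.Re (F y) : R) * (fun y => (N y)^-1).
    by apply/funext => y; exact: ReV.
  exact: differentiableM.
have -> : (fun y => complex.Im (F y)^-1 : R^o) =
    - ((fun y => complex.Im (F y) : R) * (fun y => (N y)^-1)).
  by apply/funext => y; exact: ImV.
by apply: differentiableN; exact: differentiableM.
Qed.

(** The determinant is the Leibniz sum, a polynomial in the entries. *)
Lemma cdifferentiable_det m (A : V -> 'M[R[i]]_m) x :
  (forall i j, cdifferentiable (fun y => A y i j) x) ->
  cdifferentiable (fun y => \det (A y)) x.
Proof.
move=> dA; apply: cdifferentiable_sum => s.
apply: cdifferentiableM; first exact: cdifferentiable_cst.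
exact: cdifferentiable_prod.
Qed.

Lemma cdifferentiable_mulmx m p q (A : V -> 'M[R[i]]_(m, p))
    (B : V -> 'M[R[i]]_(p, q)) x i j :
  (forall i j, cdifferentiable (fun y => A y i j) x) ->
  (forall i j, cdifferentiable (fun y => B y i j) x) ->
  cdifferentiable (fun y => (A y *m B y) i j) x.
Proof.
move=> dA dB; under eq_fun do rewrite mxE.
by apply: cdifferentiable_sum => k; exact: cdifferentiableM.
Qed.

Lemma cdifferentiable_adjugate m (A : V -> 'M[R[i]]_m) x i j :
  (forall i j, cdifferentiable (fun y => A y i j) x) ->
  cdifferentiable (fun y => (\adj (A y)) i j) x.
Proof.
move=> dA; under eq_fun do rewrite mxE /cofactor.
apply: cdifferentiableM; first exact: cdifferentiable_cst.
apply: cdifferentiable_det => k l; under eq_fun do rewrite !mxE.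
exact: dA.
Qed.

End ComplexDifferentiable.

(** By the spectral theorem the determinant is the product of the eigenvalues, and each eigenvalue
    is the value of the form at a row of the unitary matrix [P]. In the order of [R[i]],
    [0 < \det A] also says that the determinant is real. *)
Lemma det_gt0_of_posdef (R : realType) m (A : 'M[R[i]]_m) :
  A \is hermsymmx -> (forall v : 'rV_m, v != 0 -> 0 < (v *m A *m v ^t*) 0 0) ->
  0 < \det A.
Proof.
move=> hA pA.
have /hermitian_normalmx /orthomx_spectralP AE := hA.
set P := spectralmx A in AE; set sp := spectral_diag A in AE.
have uP : P \in unitmx by exact: spectral_unit.
have -> : \det A = \prod_i sp 0 i.
  by rewrite AE !det_mulmx mulrAC -det_mulmx mulVmx// det1 mul1r det_diag.
apply: prodr_gt0 => i _.
(* A zero row of the invertible [P] would make a standard basis vector zero. *)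
have Pi0 : row i P != 0.
  apply/negP => /eqP; rewrite rowE => /(congr1 (mulmx^~ (invmx P))).
  rewrite mulmxK// mul0mx => /matrixP/(_ 0 i)/eqP.
  by rewrite !mxE !eqxx oner_eq0.
have := pA _ Pi0.
suff -> : (row i P *m A *m (row i P) ^t*) 0 0 = sp 0 i by [].
have PA : P *m A *m (P ^t*) = diag_mx sp.
  rewrite [in LHS]AE !mulmxA mulmxV// mul1mx.
  by rewrite -mulmxA -invmx_unitary ?spectral_unitarymx// mulmxV// mulmx1.
have := congr1 (fun M : 'M[R[i]]_m => M i i) PA.
rewrite [in RHS]mxE eqxx mulr1n => <-.
rewrite -row_mul [LHS]mxE [RHS]mxE; apply: eq_bigr => k _.
by rewrite !mxE.
Qed.

(** * The covariance matrix and differentiability of the maximum-likelihood cost *)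

Section MaximumLikelihoodCost.
Context {R : realType} {n0 n M : nat}.
Variables (C : 'M[R[i]]_(n0, n)) (sigma : R) (Y : 'M[R[i]]_(n0, M)).

Lemma covE x i j : cov C sigma x i j =
  \sum_k C i k * (x k 0)%:C * (C j k)^*%R + (sigma ^+ 2)%:C *+ (i == j).
Proof.
rewrite /cov !mxE; congr (_ + _); apply: eq_bigr => k _.
rewrite !mxE; congr (_ * _).
rewrite (bigD1 k)//= big1 ?addr0 => [|l lk]; rewrite !mxE ?eqxx ?mulr1n//.
by rewrite (negbTE lk) mulr0n mulr0.
Qed.

Lemma cdifferentiable_cov x i j :
  cdifferentiable (fun y => cov C sigma y i j) x.
Proof.
under eq_fun do rewrite covE.
apply: cdifferentiableD; last exact: cdifferentiable_cst.
apply: cdifferentiable_sum => k.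
apply: cdifferentiableM; last exact: cdifferentiable_cst.
apply: cdifferentiableM; first exact: cdifferentiable_cst.
apply: cdifferentiable_real; exact: differentiable_coord.
Qed.

Hypothesis sigma0 : 0 < sigma.

Lemma cov_herm x : cov C sigma x \is hermsymmx.
Proof.
apply/is_hermitianmxP; rewrite expr0 scale1r; apply/matrixP => i j.
rewrite [RHS]mxE [X in Num.conj X]mxE !covE rmorphD/= rmorph_sum/= rmorphMn/=.
rewrite (eq_sym j).
have cr (a : R) : (a%:C)^*%R = a%:C :> R[i] by exact: conjc_real.
rewrite cr; congr (_ + _); apply: eq_bigr => k _.
by rewrite !rmorphM/= cr conjCK [LHS]mulrAC [RHS]mulrAC [C i k * _]mulrC.
Qed.

(** For [x] in the orthant the signal part of the form is [\sum_k x_k |(v C)_k|^2 >= 0]; the noise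
    part [sigma^2 |v|^2] makes the sum strictly positive. *)
Lemma cov_det_gt0 x : nonneg_orthant x -> 0 < \det (cov C sigma x).
Proof.
move=> x0; apply: det_gt0_of_posdef; first exact: cov_herm.
move=> v v0.
have sq k p (w : 'rV[R[i]]_p) : (w *m w ^t*) 0 k = \sum_i w 0 i * (w 0 i)^*%R.
  rewrite mxE; apply: eq_bigr => i _; rewrite !mxE.
  by rewrite (ord1 k).
rewrite /cov mulmxDr mulmxDl mxE ltr_wpDl//.
  set D := (X in C *m X *m _).
  have -> : v *m (C *m D *m C ^t*) *m v ^t* = (v *m C) *m D *m (v *m C) ^t*.
    by rewrite trmx_mul map_mxM !mulmxA.
  rewrite mxE; apply: sumr_ge0 => k _.
  rewrite mul_mx_diag !mxE mulrAC mulr_ge0//.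
    exact: mul_conjC_ge0.
  by rewrite ler0c.
rewrite mul_mx_scalar -scalemxAl mxE sq mulr_gt0 ?(ltcR 0) ?exprn_gt0//.
rewrite lt_def; apply/andP; split.
  apply: contra v0 => /eqP s0; apply/eqP/rowP => i; rewrite mxE.
  have /(_ i isT)/eqP := psumr_eq0P (fun i _ => mul_conjC_ge0 (v 0 i)) s0.
  by rewrite mul_conjC_eq0 => /eqP.
by apply: sumr_ge0 => i _; exact: mul_conjC_ge0.
Qed.

(** Boundary points of the orthant are included: a positive determinant at [x] stays positive
    nearby, also outside the orthant. There Cramer's rule writes the cost as a composition of
    differentiable functions of the entries of [cov]. *)
Lemma ml_cost_grad_diff x : nonneg_orthant x -> grad_diff (ml_cost C sigma Y) x.
Proof.
move=> x0.
have dx := cov_det_gt0 x0.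
have ddet : cdifferentiable (fun y => \det (cov C sigma y)) x.
  by apply: cdifferentiable_det => i j; exact: cdifferentiable_cov.
have Rdet0 : 0 < complex.Re (\det (cov C sigma x)).
  by move: dx; rewrite ltcE => /andP[].
pose q (y : 'cV[R]_n) : R[i] := (\det (cov C sigma y))^-1 *
  \tr (\adj (cov C sigma y) *m sample_cov Y).
have dq : cdifferentiable q x.
  apply: cdifferentiableM.
    by apply: cdifferentiableV => //; rewrite gt_eqF.
  apply: cdifferentiable_sum => i; apply: cdifferentiable_mulmx => k l.
    by apply: cdifferentiable_adjugate => *; exact: cdifferentiable_cov.
  exact: cdifferentiable_cst.
pose p (y : 'cV[R]_n) : R := complex.Re (\det (cov C sigma y)).
have dlnp : differentiable ((@ln R : R -> R) \o p) x.
  apply: differentiable_comp; first by case: ddet.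
  by apply/derivable1_diffP; have [] := is_derive1_ln Rdet0.
pose f1 : 'cV[R]_n -> R^o :=
  ((@ln R : R -> R) \o p) + (fun y => complex.Re (q y)).
have df1 : differentiable f1 x by apply: differentiableD => //; case: dq.
(* [invmx] is the identity on singular matrices, so the adjugate formula is
   only valid where the determinant does not vanish. *)
have near_f : \forall y \near x, f1 y = (ml_cost C sigma Y y : R^o).
  have := differentiable_continuous ddet.1.
  move=> /cvgr_gt/(_ 0 Rdet0); apply: filterS => y Ry.
  have uy : cov C sigma y \in unitmx.
    rewrite unitmxE unitfE; apply: contraTneq Ry => ->.
    by rewrite ltxx.
  congr (ln _ + complex.Re _).
  by rewrite /invmx uy -scalemxAl mxtraceZ.
have D1 v : is_derive x v (ml_cost C sigma Y : _ -> R^o) ('d f1 x v).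
  apply: (near_eq_is_derive near_f); split; first exact: diff_derivable.
  exact: deriveE.
move=> v; apply: is_derive_eq (D1 v) _.
(* Expanding [v] in the standard basis turns the linear differential into the inner product with the
   partial derivatives. *)
rewrite {1}(_ : v = \sum_i v i 0 *: delta_mx i 0).
  rewrite linear_sum/=; apply: eq_bigr => i _.
  rewrite linearZ/= mulrC; congr (_ * _); rewrite mxE.
  by have [_ ->] := D1 (delta_mx i 0).
rewrite [LHS]matrix_sum_delta; apply: eq_bigr => i _.
by rewrite big_ord1.
Qed.

End MaximumLikelihoodCost.

(* The rate applied to the decoding objective *)
Local Close Scope sesquilinear_scope.
Local Close Scope complex_scope.

Theorem theorem1 (R : realType) (J n0 M L l : nat)
    (C : 'M[R[i]]_(n0, 2 ^ J)) (sigma : R)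
    (Y : nat -> 'M[R[i]]_(n0, M))
    (Lset : nat -> {set 'I_(2 ^ J)})
    (Ka : nat) (idx : 'I_Ka -> nat -> 'I_(2 ^ J))
    (act : nat -> 'cV[R]_(2 ^ J))
    (alpha beta Cf eta : R) (etat : nat -> R)
    (D : set 'cV[R]_(2 ^ J))
    (gam : nat -> 'cV[R]_(2 ^ J)) (gams : 'cV[R]_(2 ^ J)) :
  let f := ml_cost C sigma (Y l) in
  let g := @l1_norm R (2 ^ J) in
  let phi := stitch_cost (Lset l) (fun k => center M l act (idx k)) in
  let h := fun x => alpha * g x + beta * phi x in
  let xi := fun x => f x + alpha * g x + beta * phi x in
  let orth := @nonneg_orthant R (2 ^ J) in
  let feas := @feasible R (2 ^ J) (Lset l) in
  (0 < n0)%N -> (0 < M)%N -> (1 < l <= L)%N -> (0 < Ka)%N ->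
  0 < sigma -> 0 < alpha -> 0 < beta ->
  (forall k i, (0 < i < l)%N -> 0 < act i (idx k i) 0) ->
  (* D : the convex region on which convexity and smoothness are assumed;
     D := orth is the case where they are assumed everywhere *)
  D `<=` orth -> convex_set (M := 'cV[R]_(2 ^ J)) D ->
  (forall t, D (gam t)) -> D gams ->
  (* the iteration *)
  (forall t, is_prox feas (etat t) h
               (gam t - etat t *: grad f (gam t)) (gam t.+1)) ->
  (* assumption (1) *)
  convex_function (E := 'cV[R]_(2 ^ J)) D f ->
  0 < Cf ->
  (forall x y, D x -> D y ->
     enorm (grad f x - grad f y) <= Cf * enorm (x - y)) ->
  (* assumption (2) *)
  convex_function (E := 'cV[R]_(2 ^ J)) D g ->
  convex_function (E := 'cV[R]_(2 ^ J)) (D `&` feas) phi ->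
  (forall (s : R) v, 0 < s -> exists x, is_prox orth s g v x) ->
  (forall (s : R) v, 0 < s -> exists x, is_prox feas s phi v x) ->
  (* assumption (3) *)
  is_prox feas eta h (gams - eta *: grad f gams) gams ->
  argmin_on feas xi gams ->
  (* step size *)
  (forall t, etat t = eta) -> 0 < eta <= 1 / Cf ->
  [/\ forall t, (0 < t)%N ->
        xi (gam t) - xi gams
          <= 1 / (2 * t%:R * eta) * enorm (gam 0%N - gams) ^+ 2,
      (xi (gam t) : R^o) @[t --> \oo] --> (xi gams : R^o) &
      (fun t => xi (gam t) - xi gams : R^o)
        =O_\oo (fun t => t%:R^-1 : R^o)].
Proof.
move=> f g phi h xi orth feas _ _ _ _ sigma0 alpha0 beta0 _ Dorth cD Dgam Dgams.
move=> iter cf Cf0 lip cg cphi _ _ _ gams_min etaE /andP[eta0 etaC].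
have cfeas : convex_set (M := 'cV[R]_(2 ^ J)) feas by exact: feasible_convex.
have ch : convex_function (E := 'cV[R]_(2 ^ J)) (D `&` feas) h.
  apply: convex_functionD; [exact: ltW | exact: ltW | | exact: cphi].
  by apply: sub_convex_function cg => z [].
(* Differentiability of [f] on [D] is derived, not assumed: [D] lies in the orthant and the noise
   variance is positive. *)
have df z : D z -> grad_diff f z by move=> /Dorth; exact: ml_cost_grad_diff.
(* Otherwise conversion tries to evaluate the determinants in [f]. *)
clearbody f g phi.
have iter' t : is_prox feas eta h (gam t - eta *: grad f (gam t)) (gam t.+1).
  by have := iter t; rewrite etaE.
have xiE x : xi x = f x + h x by rewrite /xi /h addrA.
have rate t : (0 < t)%N -> xi (gam t) - xi gams
    <= 1 / (2 * t%:R * eta) * enorm (gam 0%N - gams) ^+ 2.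
  rewrite !xiE; apply: (prox_grad_rate cD cfeas cf ch df lip) => //.
  by split=> //; case: gams_min.
have invM_natE (e : R) t : (0 < t)%N ->
    1 / (2 * t%:R * eta) * e = (2 * eta)^-1 * e * t%:R^-1.
  by move=> t0; field; rewrite !gt_eqF ?ltr0n.
have [||cvg_xi bigO_xi] := @cvg_bigO_of_le_inv R (xi \o gam) (xi gams)
    ((2 * eta)^-1 * enorm (gam 0%N - gams) ^+ 2).
(* Minimality of [gams] over [feas] gives the lower bound at every proximal output, that is from
   index 1 on. *)
- by case=> // t _; apply: gams_min.2; case: (iter' t).
- move=> t t0; rewrite -invM_natE//; exact: rate.
- by split.
Qed.
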